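(* For any finite abelian group $H$, the group $\mathbf{C}_2 \times H$ is realizable as the group of units in a ring of characteristic zero. Moreover, the density of such groups in the class $\mathcal{A}$ of finite abelian groups is $1/2$: if $\mathcal{Q}$ denotes the collection of isomorphism classes of finite abelian groups of the form $\mathbf{C}_2 \times H$ with $H$ a finite abelian group, then \[ \lim_{x \to \infty} \frac{\mathcal{Q}(x)}{\mathcal{A}(x)} = \frac12 . \]
   Context: $\mathbf{C}_2$ is the cyclic group of order $2$. All rings are associative with a multiplicative identity; a group $G$ is realizable as the group of units in a ring $R$ if $G \cong R^\times$, where $R^\times$ is the multiplicative group of units of $R$. For a class $\mathcal{C}$ of finite groups up to isomorphism and a positive real $x$, $\mathcal{C}(x)$ denotes the number of isomorphism classes of groups in $\mathcal{C}$ of order at most $x$. The density of a class $\mathcal{C}$ contained in a class $\mathcal{D}$ is $\lim_{x\to\infty} \mathcal{C}(x)/\mathcal{D}(x)$, if the limit exists. *)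

(* Defs.v *)
From HB Require Import structures.
From mathcomp Require Import all_boot all_order all_algebra all_fingroup.
From mathcomp Require Import all_classical all_reals all_analysis.
Set Implicit Arguments.
Unset Strict Implicit.
Unset Printing Implicit Defensive.
Import Order.TTheory GRing.Theory Num.Theory.
Import numFieldNormedType.Exports.
Local Open Scope ring_scope.

(* [{unit R}] is only available in the library for finite rings. The choice   *)
(* of [unitRingType] is no restriction: by [unitrP], [GRing.unit] is exactly  *)
(* the set of two-sided invertible elements, and it is decidable classically. *)
Section UnitGroup.
Variable R : unitRingType.

Record units := Units { units_val :> R; unitsP : units_val \is a GRing.unit }.

HB.instance Definition _ := [isSub for units_val].
HB.instance Definition _ := [Choice of units by <:].

Implicit Types u v w : units.

Definition units_one : units := Units (unitr1 R).
Definition units_inv u : units :=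
  Units (etrans (unitrV (units_val u)) (unitsP u)).

Fact units_mul_subproof u v : units_val u * units_val v \is a GRing.unit.
Proof. by rewrite unitrMr ?unitsP. Qed.
Definition units_mul u v : units := Units (units_mul_subproof u v).

Fact units_mulA : associative units_mul.
Proof. by move=> u v w; apply: val_inj; rewrite /= mulrA. Qed.
Fact units_mul1 : left_id units_one units_mul.
Proof. by move=> u; apply: val_inj; rewrite /= mul1r. Qed.
Fact units_mulr1 : right_id units_one units_mul.
Proof. by move=> u; apply: val_inj; rewrite /= mulr1. Qed.
Fact units_mulV : left_inverse units_one units_inv units_mul.
Proof. by move=> u; apply: val_inj; rewrite /= mulVr ?unitsP. Qed.
Fact units_mulrV : right_inverse units_one units_inv units_mul.
Proof. by move=> u; apply: val_inj; rewrite /= divrr ?unitsP. Qed.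

HB.instance Definition _ := isGroup.Build units
  units_mulA units_mul1 units_mulr1 units_mulV units_mulrV.

End UnitGroup.

Definition group_isomorphic (G K : groupType) : Prop :=
  exists f : G -> K, bijective f /\ {morph f : x y / (x * y)%g}.

(* [[pchar R] =i pred0] would be too weak: it also holds in ['Z_6].           *)
Definition char_zero (R : nzRingType) : Prop :=
  forall n : nat, n%:R = 0 :> R -> n = 0%N.

Definition realizable_in_char_zero (G : groupType) : Prop :=
  exists R : unitRingType, char_zero R /\ group_isomorphic G (units R).

Definition C2x (H : finGroupType) : finGroupType := ('Z_2 * H)%type.


Definition group_class := finGroupType -> Prop.

Definition abelian_groups : group_class := fun G => abelian [set: G].

Definition C2x_groups : group_class := fun G =>
  exists H : finGroupType, abelian [set: H] /\ [set: G] \isog [set: C2x H].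

Section ClassCount.
Variables (R : realType) (C : group_class) (x : R).

Definition in_class_upto (G : finGroupType) : Prop := C G /\ #|G|%:R <= x.

(* [N] is the number of isomorphism classes of groups in [C] of order at most *)
(* [x]: there is a complete irredundant family of [N] representatives. (The   *)
(* type [set finGroupType] of sets of groups is ruled out by the universe     *)
(* constraints of the library, hence no set of isomorphism classes.)          *)
Definition is_class_count (N : nat) : Prop :=
  exists s : 'I_N -> finGroupType,
    [/\ forall i, in_class_upto (s i),
        forall i j, [set: s i] \isog [set: s j] -> i = j
      & forall G, in_class_upto G -> exists i, [set: G] \isog [set: s i]].

(* The default value 0 is never used: see [class_countP].                     *)
Definition class_count : nat := xget 0%N [set N | is_class_count N]%classic.

Lemma is_class_count_leq N M :
  is_class_count N -> is_class_count M -> (N <= M)%N.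
Proof.
move=> [s [sC sI _]] [t [_ _ tS]].
have /fin_all_exists [f fP] i : exists j, [set: s i] \isog [set: t j].
  exact: tS (sC i).
have f_inj : injective f.
  move=> i j fij; apply: sI; apply: isog_trans (fP i) _.
  by rewrite isog_sym fij.
by have := leq_card f f_inj; rewrite !card_ord.
Qed.

Lemma is_class_count_unique N M :
  is_class_count N -> is_class_count M -> N = M.
Proof.
by move=> hN hM; apply/eqP; rewrite eqn_leq !is_class_count_leq.
Qed.

Let codes n (c : {set 'I_n} * {ffun 'I_n * 'I_n -> 'I_n}) (G : finGroupType) :=
  exists f : G -> 'I_n, [/\ injective f, [set f y | y in [set: G]] = c.1
    & forall y z, f (y * z)%g = c.2 (f y, f z)].

Let codes_isog n c (G K : finGroupType) :
  @codes n c G -> codes c K -> [set: G] \isog [set: K].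
Proof.
move=> [f [f_inj fA fM]] [g [g_inj gA gM]].
have /fin_all_exists [h hP] y : exists z, g z = f y.
  have : f y \in c.1 by rewrite -fA imset_f.
  by rewrite -gA => /imsetP [z _ ->]; exists z.
have h_inj : injective h by move=> y z hyz; apply: f_inj; rewrite -!hP hyz.
have hM : {in [set: G] &, {morph h : y z / (y * z)%g}}.
  by move=> y z _ _; apply: g_inj; rewrite hP gM !hP fM.
apply/isogP; exists (Morphism hM); first by apply/injmP => y z _ _ /h_inj.
apply/setP => z; rewrite inE morphimEdom; apply/imsetP.
have : g z \in c.1 by rewrite -gA imset_f.
rewrite -fA => /imsetP [y _ gz]; exists y => //=.
by apply: g_inj; rewrite hP.
Qed.

Let codes_exist n (G : finGroupType) :
  (#|G| <= n)%N -> exists c, @codes n c G.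
Proof.
move=> Gn; pose f (y : G) := widen_ord Gn (enum_rank y).
have f_inj : injective f.
  by move=> y z /(congr1 val) /= /val_inj /enum_rank_inj.
pose g i : G := odflt 1%g [pick y | f y == i].
have fK : cancel f g.
  move=> y; rewrite /g; case: pickP => [z /eqP/f_inj //|/(_ y)].
  by rewrite eqxx.
exists ([set f y | y in [set: G]], [ffun p => f (g p.1 * g p.2)%g]).
by exists f; split=> // y z; rewrite ffunE /= !fK.
Qed.

Lemma class_count_exists : exists N, is_class_count N.
Proof.
have [n xn] : exists n : nat, x <= n%:R.
  exists (Num.bound `|x|).
  by rewrite ltW// (le_lt_trans (ler_norm x))// archi_boundP.
pose P N := exists s : 'I_N -> finGroupType,
  (forall i, in_class_upto (s i)) /\
  (forall i j, [set: s i] \isog [set: s j] -> i = j).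
have Pub N : `[< P N >] ->
    (N <= #|{: {set 'I_n} * {ffun 'I_n * 'I_n -> 'I_n}}|)%N.
  move=> /asboolP [s [sC sI]].
  have /fin_all_exists [c cP] i : exists c, @codes n c (s i).
    by apply: codes_exist; rewrite -(ler_nat R) (le_trans (sC i).2).
  have c_inj : injective c.
    by move=> i j cij; apply: sI; apply: (codes_isog (cP i)); rewrite cij.
  by have := leq_card c c_inj; rewrite card_ord.
have P0 : exists N, `[< P N >].
  exists 0%N; apply/asboolP; exists (fun=> ('Z_2 : finGroupType)).
  by split; case.
case: (ex_maxnP P0 Pub) => N /asboolP [s [sC sI]] Nmax.
exists N, s; split=> // G GC; apply: contrapT => nG.
have nG' i : ~ [set: G] \isog [set: s i] by move=> Gi; apply: nG; exists i.
suff /asboolP/Nmax : P N.+1 by rewrite ltnn.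
exists (fun i => if unlift ord0 i is Some j then s j else G); split.
  by move=> i; case: (unliftP ord0 i).
move=> i j; case: (unliftP ord0 i) => [i'|] ->; case: (unliftP ord0 j) => [j'|] ->.
- by move=> /sI ->.
- by rewrite isog_sym => /nG'.
- by move=> /nG'.
- by [].
Qed.

Lemma class_countP : is_class_count class_count.
Proof. exact: (@xgetPex _ 0%N [set N | is_class_count N]%classic) class_count_exists. Qed.

End ClassCount.

(* Main.v *)
Require Import Defs.
From HB Require Import structures.
From mathcomp Require Import all_boot all_order all_algebra all_fingroup.
From mathcomp Require Import all_solvable ring lra.
From mathcomp Require Import all_classical all_reals all_analysis.
Import Order.TTheory GRing.Theory Num.Theory.
Import numFieldNormedType.Exports.

(** Realizability.  Write the abelian group [H] additively and let the integers
    act on it.  In the trivial extension of the integers by [H], the product is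
    (a, u) (b, v) = (a b, a v + b u), so a pair is invertible exactly when its
    first coordinate is 1 or -1, and (-1)^a (1, v) parametrizes the units by
    [C2 x H].  This ring contains the integers, hence has characteristic zero.

    Density.  The number of solutions of x ^ n = 1 in an abelian group with
    invariant factors d_1, d_2, ... is the product of the gcd(n, d_i), and these
    numbers determine the divisibility chain [d] ([dvdn_chain_eq_prod_gcd]).
    They are multiplicative in direct products and positive, so [C2] cancels:
    [C2 x H] determines [H] up to isomorphism, and the number Q(x) of classes of
    groups [C2 x H] of order at most x is A(x / 2), where A counts all abelian
    groups ([C2x_class_count]).

    It remains to see that A(x / 2) / A(x) tends to 1/2.  Setting
    m_i = d_i / d_(i+1) turns a chain into an arbitrary sequence of positive
    integers, and the order of the group into the product of the m_i ^ i.
    Summing over m_1 first,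
      A(n) = sum over F = (m_2, m_3, ...) of floor(n / |F|),
    with |F| = m_2^2 m_3^3 ...  Since floor(t) - 2 floor(t / 2) is 0 or 1, and
    is 0 for t < 1, the difference A(n) - 2 A(n / 2) lies between 0 and
    the number G(n) of tails F with |F| <= n ([card_codes_half]).  All exponents
    in |F| are at least 2, so G(n) is o(n): by Rankin's trick,
      G(n) <= n^(3/4) * (sum over F of |F|^(-3/4)),
    where the last sum is the product over k >= 2 of zeta(3 k / 4), which
    converges because 3 k / 4 >= 3 / 2 and zeta(s) - 1 decays exponentially
    ([card_small_tails]).  As A(n) >= n, the
    ratio A(n / 2) / A(n) differs from 1/2 by O(n^(-1/4)). *)

Set Implicit Arguments.
Unset Strict Implicit.
Unset Printing Implicit Defensive.

(** * Units of the trivial extension of the integers by an abelian group *)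

(** The additive notation needs a copy of the type that carries the
    commutativity proof. *)
Definition additive (G : finGroupType) (cG : abelian [set: G]) : Type := G.

Section Additive.
Local Open Scope group_scope.
Variables (G : finGroupType) (cG : abelian [set: G]).

HB.instance Definition _ := Choice.on (additive cG).

Lemma additiveC : commutative (mulg : G -> G -> G).
Proof. by move=> x y; apply: (centsP cG); rewrite inE. Qed.

HB.instance Definition _ := GRing.isZmodule.Build (additive cG)
  (@mulgA G) additiveC (@mul1g G) (@mulVg G).
End Additive.

Definition trivial_extension (V : zmodType) : Type := (int * V)%type.

Section TrivialExtension.
Local Open Scope ring_scope.
Variable V : zmodType.
Local Notation R := (trivial_extension V).

HB.instance Definition _ := GRing.Zmodule.on R.

Definition triv_one : R := (1, 0).
Definition triv_mul (x y : R) : R := (x.1 * y.1, y.2 *~ x.1 + x.2 *~ y.1).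

Fact triv_mulA : associative triv_mul.
Proof.
move=> [a u] [b v] [c w]; congr (_, _); rewrite /= ?mulrA//.
by rewrite !mulrzDl -!mulrzA addrA (mulrC b a) (mulrC c a).
Qed.
Fact triv_mulC : commutative triv_mul.
Proof. by move=> [a u] [b v]; congr (_, _); rewrite /= 1?mulrC 1?addrC. Qed.
Fact triv_mul1 : left_id triv_one triv_mul.
Proof. by move=> [a u]; rewrite /triv_mul /= mul1r mul0rz addr0. Qed.
Fact triv_mulDl : left_distributive triv_mul +%R.
Proof.
move=> [a u] [b v] [c w]; congr (_, _); rewrite /= ?mulrDl//.
by rewrite mulrzDr mulrzDl addrACA.
Qed.
Fact triv_oner_neq0 : triv_one != 0.
Proof. by []. Qed.

HB.instance Definition _ := GRing.Zmodule_isComNzRing.Build R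
  triv_mulA triv_mulC triv_mul1 triv_mulDl triv_oner_neq0.

Definition triv_unit : {pred R} := fun x => (x.1 == 1) || (x.1 == -1).
Definition triv_inv (x : R) : R := if x \in triv_unit then (x.1, - x.2) else x.

Fact triv_mulVx : {in triv_unit, left_inverse 1 triv_inv *%R}.
Proof.
move=> x ux; rewrite /triv_inv ux; case: x ux => a u /orP[] /eqP /= ->;
  congr (_, _) => //=; by rewrite mulNrz subrr.
Qed.
Fact triv_unitPl (x y : R) : y * x = 1 -> x \in triv_unit.
Proof. by case=> /intUnitRing.unitzPl. Qed.
Fact triv_inv_out : {in [predC triv_unit], triv_inv =1 id}.
Proof. by move=> x /negPf xn; rewrite /triv_inv xn. Qed.

HB.instance Definition _ := GRing.ComNzRing_hasMulInverse.Build R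
  triv_mulVx triv_unitPl triv_inv_out.

Lemma trivial_extension_char_zero : char_zero R.
Proof.
have nE n : (n%:R : R).1 = n%:R.
  by elim: n => // n IH; rewrite -natr1 /= IH natr1.
by move=> n /(congr1 fst); rewrite nE => /eqP; rewrite pnatr_eq0 => /eqP.
Qed.

Fact sign_unit (a : 'Z_2) (v : V) :
  (((-1) ^+ a, v *~ (-1) ^+ a) : R) \is a GRing.unit.
Proof. by case: a => -[|[|//]]. Qed.

(** [(-1)^a * (1, v)], a product of two commuting units. *)
Definition sign_translation (x : 'Z_2 * V) : units R :=
  Units (sign_unit x.1 x.2).

Lemma sign_translation_bij : bijective sign_translation.
Proof.
pose g (u : units R) : 'Z_2 * V :=
  (if (val u).1 == 1 then 0 else 1, (val u).2 *~ (val u).1).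
exists g.
  by case=> -[[|[|//]] i] v; rewrite /g /=; congr (_, _);
    rewrite ?mulrNz ?opprK //; apply/val_inj.
case=> -[a v] /= u; apply/val_inj; rewrite /g /=.
case/orP: (u) => /= /eqP -> /=; congr (_, _).
by rewrite -mulrzA.
Qed.

Lemma sign_translationM (x y : 'Z_2 * V) :
  sign_translation (x.1 + y.1, x.2 + y.2) =
  (sign_translation x * sign_translation y)%g.
Proof.
apply/val_inj; case: x y => [a u] [b v] /=.
have ab : (-1) ^+ (a + b)%R = (-1) ^+ a * (-1) ^+ b :> int.
  by case: a b => -[|[|//]] ? [[|[|//]] ?].
by congr (_, _); rewrite /= ab// mulrzDl -!mulrzA addrC (mulrC ((-1) ^+ b)).
Qed.

End TrivialExtension.

Lemma C2x_realizable (H : finGroupType) : abelian [set: H]%SET ->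
  realizable_in_char_zero (C2x H).
Proof.
move=> cH; exists (trivial_extension (additive cH)); split.
  exact: trivial_extension_char_zero.
exists (@sign_translation (additive cH)); split.
  exact: sign_translation_bij.
by move=> x y; apply: (@sign_translationM (additive cH)).
Qed.

(** * Solutions of x ^ n = 1 in products of cyclic groups *)

Section Torsion.
Local Open Scope group_scope.
Local Open Scope nat_scope.

(** With m the order of x and g = gcd(n, m), the n-torsion of the cyclic group
    is the subgroup generated by x ^ (m / g): if m divides i n, then m / g
    divides i, because m / g and n / g are coprime. *)
Lemma card_Ldiv_cycle (gT : finGroupType) (x : gT) n :
  #|'Ldiv_n(<[x]>)| = gcdn n #[x]%g.
Proof.
set m := #[x]%g; have m0 : 0 < m := order_gt0 x.
have g_m : gcdn n m %| m := dvdn_gcdr n m.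
have g0 : 0 < gcdn n m by rewrite gcdn_gt0 m0 orbT.
suff -> : 'Ldiv_n(<[x]>) = <[x ^+ (m %/ gcdn n m)]>.
  rewrite -orderE orderXdiv ?dvdn_div// -/m -{1}(divnK g_m) mulKn//.
  by rewrite divn_gt0// dvdn_leq.
apply/setP => y; apply/LdivP/cycleP => [[/cycleP[i ->]]|[i ->]].
  move=> /eqP; rewrite -expgM -order_dvdn -/m => m_in.
  suff /dvdnP[k ->] : m %/ gcdn n m %| i by exists k; rewrite -expgM mulnC.
  rewrite -(@Gauss_dvdl _ _ (n %/ gcdn n m)).
    by rewrite -(dvdn_pmul2r g0) -mulnA !divnK ?dvdn_gcdl.
  rewrite /coprime -(eqn_pmul2r g0) mul1n muln_gcdl.
  by rewrite !divnK ?dvdn_gcdl// gcdnC.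
split; first by rewrite -expgM mem_cycle.
apply/eqP; rewrite -!expgM -order_dvdn -/m mulnC -mulnA muln_divCA_gcd.
by rewrite dvdn_mull ?dvdn_mulr.
Qed.

(** The product map from [A x B] to [G] is a bijection which preserves and
    reflects the equation x ^ n = 1. *)
Lemma card_Ldiv_dprod (gT : finGroupType) (A B : {set gT}) (G : {group gT}) n :
  A \x B = G -> #|'Ldiv_n(G)| = #|'Ldiv_n(A)| * #|'Ldiv_n(B)|.
Proof.
move=> dG; have [[H K defA defB] _ cHK tiHK] := dprodP dG.
subst A B; rewrite -cardsX.
have mulI : {in finset.setX H K &, injective (fun u : gT * gT => u.1 * u.2)%g}.
  move=> [a b] [c d] /setXP[/= Ha Kb] /setXP[/= Hc Kd] e.
  have [|y [z [_ _ _ U]]] := mem_dprod dG (x := (a * b)%g).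
    by rewrite -(dprodW dG) mem_mulg.
  have [-> ->] := U _ _ Ha Kb erefl.
  by have [-> ->] := U _ _ Hc Kd e.
rewrite -(card_in_imset (f := fun u : gT * gT => (u.1 * u.2)%g)); last first.
  apply: sub_in2 mulI => -[a b] /setXP[/= /LdivP[Ha _] /LdivP[Kb _]].
  by rewrite inE /= Ha.
apply: eq_card => x; apply/LdivP/imsetP => [[Gx xn]|].
  have [y [z [Hy Kz xE _]]] := mem_dprod dG Gx; exists (y, z) => //.
  have cyz : commute y z by apply/commute_sym/(centsP cHK).
  move: xn; rewrite xE expgMn// => /eqP; rewrite -eq_invg_mul => /eqP e.
  have z1 : (z ^+ n)%g = 1%g.
    have : (z ^+ n)%g \in H :&: K by rewrite inE -{1}e groupV !groupX.
    by rewrite tiHK => /set1P.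
  have y1 : (y ^+ n)%g = 1%g.
    by move: e; rewrite z1 => /(congr1 invg); rewrite invgK invg1.
  by apply/setXP; split; apply/LdivP.
case=> -[a b] /setXP[/= /LdivP[Ha an] /LdivP[Kb bn]] ->; split.
  by rewrite -(dprodW dG) mem_mulg.
by rewrite expgMn ?an ?bn ?mulg1//; apply/commute_sym/(centsP cHK).
Qed.

Lemma card_Ldiv0 (gT : finGroupType) (G : {group gT}) : #|'Ldiv_0(G)| = #|G|.
Proof. by apply: eq_card => x; rewrite !inE expg0 eqxx andbT. Qed.

Lemma expg_pair (G K : finGroupType) (x : (G * K)%type) n :
  (x ^+ n)%g = ((x.1 ^+ n)%g, (x.2 ^+ n)%g).
Proof. by elim: n => [|n IH]; rewrite ?expg0 // !expgS IH. Qed.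

Lemma card_Ldiv_pair (G K : finGroupType) n :
  #|'Ldiv_n([set: (G * K)%type])| =
  #|'Ldiv_n([set: G])| * #|'Ldiv_n([set: K])|.
Proof.
rewrite -cardsX; apply: eq_card => -[x y].
by rewrite !inE expg_pair -pair_eqE.
Qed.

Lemma card_Ldiv_isog (aT rT : finGroupType)
    (G : {group aT}) (H : {group rT}) n :
  G \isog H -> #|'Ldiv_n(G)| = #|'Ldiv_n(H)|.
Proof.
case/isogP => f injf <-; rewrite -injm_Ldiv// card_injm//.
exact: subsetIl.
Qed.

Lemma card_Ldiv_abelian_type (gT : finGroupType) (G : {group gT}) n :
  abelian G -> #|'Ldiv_n(G)| = \prod_(d <- abelian_type G) gcdn n d.
Proof.
move=> /abelian_structure[b dG <-]; rewrite big_map.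
elim: b G dG => [|x b IH] G; rewrite ?big_nil ?big_cons => dG.
  rewrite -dG; have -> : 'Ldiv_n(1%g : {set gT}) = 1%g; last by rewrite cards1.
  by apply/setP=> x; rewrite !inE; case: eqP => [->|//]; rewrite expg1n eqxx.
have [[_ H _ defH] _ _ _] := dprodP dG.
by rewrite (card_Ldiv_dprod _ dG) card_Ldiv_cycle defH (IH H).
Qed.

End Torsion.

(** * Divisibility chains as isomorphism invariants *)

Section Chains.
Local Open Scope nat_scope.

(** Entries equal to 1 are allowed, so that chains can be padded to a common
    length; in [abelian_type] all entries exceed 1. *)
Definition dvdn_chain s := sorted [rel m n | n %| m] s && all (leq 1) s.

Lemma dvdn_chain_cons a s :
  dvdn_chain (a :: s) -> [/\ 0 < a, all (fun b => b %| a) s & dvdn_chain s].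
Proof.
rewrite /dvdn_chain /= => /andP[p /andP[a0 s0]]; split=> //.
- apply: (order_path_min (leT := [rel m n | n %| m])) p.
  by move=> x y z /= h1 h2; apply: dvdn_trans h2 h1.
- by rewrite s0 (path_sorted p).
Qed.

Lemma prod_seq_gt0 (s : seq nat) : all (leq 1) s -> 0 < \prod_(d <- s) d.
Proof. by move=> /allP h; rewrite big_seq prodn_cond_gt0. Qed.

(** Taking n = 0 gives the equality of the products of the entries.  For n = c
    the left product is unchanged, since every entry on the left divides c;
    hence so is the right one, although no factor gcd(c, x) exceeds x.  Every
    entry on the right, in particular d, therefore divides c. *)
Lemma dvdn_chain_head c u d v : dvdn_chain (c :: u) -> dvdn_chain (d :: v) ->
    (forall n, \prod_(x <- c :: u) gcdn n x = \prod_(x <- d :: v) gcdn n x) ->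
  d %| c.
Proof.
move=> /dvdn_chain_cons[c0 uc _] /dvdn_chain_cons[d0 _ /andP[_ v0]] H.
have prodE w : \prod_(x <- w) gcdn 0 x = \prod_(x <- w) x.
  by apply: eq_bigr => x _; rewrite gcd0n.
have prod_u : \prod_(x <- c :: u) gcdn c x = \prod_(x <- c :: u) x.
  rewrite !big_cons gcdnn; congr (_ * _); rewrite !big_seq.
  by apply: eq_bigr => x xu; apply/gcdn_idPr/(allP uc).
have prod_v : \prod_(x <- d :: v) gcdn c x = \prod_(x <- d :: v) x.
  by rewrite -H prod_u -prodE H prodE.
have le_v : \prod_(x <- v) gcdn c x <= \prod_(x <- v) x.
  rewrite !big_seq; apply: leq_prod => x xv.
  by rewrite dvdn_leq ?dvdn_gcdr//; apply: (allP v0).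
apply/gcdn_idPr/eqP; rewrite eqn_leq dvdn_leq ?dvdn_gcdr//=.
rewrite -(leq_pmul2r (prod_seq_gt0 v0)).
by move: prod_v; rewrite !big_cons => <-; rewrite leq_mul2l le_v orbT.
Qed.

(** The heads divide each other by the previous lemma; once they are equal,
    their positive contributions gcd(n, a) cancel. *)
Lemma dvdn_chain_eq_prod_gcd s t : size s = size t ->
  dvdn_chain s -> dvdn_chain t ->
  (forall n, \prod_(d <- s) gcdn n d = \prod_(d <- t) gcdn n d) -> s = t.
Proof.
elim: s t => [|a s IH] [|b t]//= [st] cs ct H.
have ab : a = b.
  by apply/eqP; rewrite eqn_dvd (dvdn_chain_head cs ct)//
    (dvdn_chain_head ct cs).
have [a0 _ cs'] := dvdn_chain_cons cs; have [_ _ ct'] := dvdn_chain_cons ct.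
congr (_ :: _) => //; apply: IH => // n; have := H n.
rewrite !big_cons -ab => /eqP; rewrite eqn_pmul2l ?gcdn_gt0 ?a0 ?orbT//.
by move/eqP.
Qed.

Lemma dvdn_chain_pad s k : dvdn_chain s -> dvdn_chain (s ++ nseq k 1).
Proof.
move=> /andP[ss s0]; rewrite /dvdn_chain all_cat s0 all_nseq orbT/= andbT.
have s1 : sorted [rel m n | n %| m] (nseq k 1) by elim: k => //= -[].
case: s ss {s0} => //= a s p; rewrite cat_path p /=.
by case: k s1 => //= k ->; rewrite dvd1n.
Qed.

Lemma prod_gcd_pad s k n :
  \prod_(d <- s ++ nseq k 1) gcdn n d = \prod_(d <- s) gcdn n d.
Proof.
rewrite big_cat/= [X in _ * X]big1_seq ?muln1// => i /nseqP[-> _].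
exact: gcdn1.
Qed.

Lemma abelian_type_chain (gT : finGroupType) (G : {group gT}) :
  dvdn_chain (abelian_type G).
Proof.
rewrite /dvdn_chain abelian_type_dvdn_sorted/=.
by apply: sub_all (abelian_type_gt1 G) => d /ltnW.
Qed.

(** Any presentation of the torsion numbers by a divisibility chain computes the
    abelian type, by uniqueness of the chain after padding both to the same
    length. *)
Lemma abelian_type_eq_chain (gT : finGroupType) (G : {group gT}) s :
  abelian G -> dvdn_chain s ->
  (forall n, #|'Ldiv_n(G)%g| = \prod_(d <- s) gcdn n d) ->
  abelian_type G = [seq d <- s | 1 < d].
Proof.
move=> cGG cs H; set t := abelian_type G.
have e : t ++ nseq (size s) 1 = s ++ nseq (size t) 1.
  apply: dvdn_chain_eq_prod_gcd; rewrite ?size_cat ?size_nseq 1?addnC//.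
  - exact/dvdn_chain_pad/abelian_type_chain.
  - exact: dvdn_chain_pad.
  by move=> n; rewrite !prod_gcd_pad -H card_Ldiv_abelian_type.
have := congr1 (seq.filter (leq 2)) e; rewrite !seq.filter_cat.
have n1 k : [seq d <- nseq k 1 | 1 < d] = [::] by rewrite filter_nseq.
rewrite !n1 !cats0 => <-; apply/esym/all_filterP; exact: abelian_type_gt1.
Qed.

Lemma isog_abelian_Ldiv (aT rT : finGroupType)
    (G : {group aT}) (H : {group rT}) :
  abelian G -> abelian H ->
  G \isog H <-> (forall n, #|'Ldiv_n(G)%g| = #|'Ldiv_n(H)%g|).
Proof.
move=> cGG cHH; split=> [GH n|e]; first exact: card_Ldiv_isog.
rewrite eq_abelian_type_isog// (@abelian_type_eq_chain _ G (abelian_type H))//.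
- by apply/eqP/all_filterP/abelian_type_gt1.
- exact: abelian_type_chain.
- by move=> n; rewrite e card_Ldiv_abelian_type.
Qed.

End Chains.

(** * Chains and their successive quotients *)

Section Multiplicities.
Local Open Scope nat_scope.

(** The inverse operation to taking the quotients d_i / d_(i+1) in a chain. *)
Fixpoint suffix_prods (e : seq nat) : seq nat :=
  if e is a :: e' then a * \prod_(x <- e') x :: suffix_prods e' else [::].

Lemma size_suffix_prods e : size (suffix_prods e) = size e.
Proof. by elim: e => //= a e ->. Qed.

Lemma suffix_prods_chain e : all (leq 1) e -> dvdn_chain (suffix_prods e).
Proof.
elim: e => //= a e IH /andP[a0 e0]; move: (IH e0); rewrite /dvdn_chain /=.
rewrite muln_gt0 a0 prod_seq_gt0//= => /andP[p ->]; rewrite andbT.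
case: e p {IH e0} => //= b e ->; rewrite andbT.
by rewrite big_cons dvdn_mull.
Qed.

(** The common length matters: trailing entries 1 of e produce trailing entries
    1 of the chain. *)
Lemma suffix_prods_inj e f : size e = size f -> all (leq 1) e ->
  suffix_prods e = suffix_prods f -> e = f.
Proof.
elim: e f => [|a e IH] [|b f]//= [sef] /andP[a0 e0] [+ /IH ef].
rewrite -ef// => /eqP; rewrite eqn_pmul2r ?prod_seq_gt0//.
by move/eqP->.
Qed.

Lemma suffix_prods_surj s : dvdn_chain s ->
  exists e, [/\ all (leq 1) e, size e = size s & suffix_prods e = s].
Proof.
elim: s => [|d s IH] cs; first by exists [::].
have [d0 ds cs'] := dvdn_chain_cons cs.
have [e [e0 _ es]] := IH cs'.
have ed : \prod_(x <- e) x %| d.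
  case: e es {e0} => [|a e] /= es; first by rewrite big_nil dvd1n.
  by rewrite big_cons; apply: (allP ds); rewrite -es mem_head.
exists (d %/ \prod_(x <- e) x :: e); split=> /=.
- by rewrite e0 divn_gt0 ?prod_seq_gt0// dvdn_leq.
- by rewrite -es size_suffix_prods.
- by rewrite divnK// es.
Qed.

(** The entry e_i occurs in the first i + 1 suffix products. *)
Lemma prod_suffix_prods e :
  \prod_(d <- suffix_prods e) d = \prod_(i < size e) nth 0 e i ^ i.+1.
Proof.
elim: e => [|a e IH] /=; rewrite ?big_nil ?big_ord0//.
rewrite big_cons big_ord_recl /= IH -mulnA; congr (_ * _).
rewrite (big_nth 0) big_mkord -big_split.
by apply: eq_bigr => i _ /=; rewrite -expnS.
Qed.

Lemma dvdn_prod_suffix_prods e x :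
  x \in e -> x %| \prod_(d <- suffix_prods e) d.
Proof.
elim: e => //= a e IH; rewrite inE big_cons => /predU1P[->|/IH xe].
  by rewrite -mulnA dvdn_mulr.
exact: dvdn_mull.
Qed.

End Multiplicities.

(** * Finite abelian groups with prescribed invariant factors *)

Section GroupOfChain.
Local Open Scope nat_scope.

(** The ordinal type is written with [d.-1.+1] to be a group for every d; it is
    cyclic of order d when d > 0. *)
Fixpoint prod_cyclic (s : seq nat) : finGroupType :=
  if s is d :: s' then ('I_d.-1.+1 * prod_cyclic s')%type else 'I_1.

Lemma pair_abelian (G K : finGroupType) :
  abelian [set: G] -> abelian [set: K] -> abelian [set: (G * K)%type].
Proof.
move=> /centsP cG /centsP cK; apply/centsP => -[a b] _ [c d] _.
by congr (_, _); [apply: cG | apply: cK]; rewrite inE.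
Qed.

Lemma ord_abelian n : abelian [set: 'I_n.+1].
Proof. by rewrite Zp_cycle cycle_abelian. Qed.

Lemma prod_cyclic_abelian s : abelian [set: prod_cyclic s].
Proof.
by elim: s => [|d s IH] /=; [|apply: pair_abelian IH]; apply: ord_abelian.
Qed.

Lemma card_Ldiv_ord n m : #|'Ldiv_n([set: 'I_m.+1])%g| = gcdn n m.+1.
Proof.
by rewrite Zp_cycle card_Ldiv_cycle orderE -Zp_cycle cardsT card_ord.
Qed.

Lemma card_Ldiv_prod_cyclic s n : all (leq 1) s ->
  #|'Ldiv_n([set: prod_cyclic s])%g| = \prod_(d <- s) gcdn n d.
Proof.
elim: s => [|d s IH] /=; first by rewrite card_Ldiv_ord gcdn1 big_nil.
move=> /andP[d0 s0].
by rewrite card_Ldiv_pair card_Ldiv_ord big_cons IH// prednK.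
Qed.

Lemma card_prod_cyclic s : all (leq 1) s -> #|prod_cyclic s| = \prod_(d <- s) d.
Proof.
move=> s0; rewrite (eq_bigr (gcdn 0)) => [|d _]; last by rewrite gcd0n.
by rewrite -card_Ldiv_prod_cyclic// card_Ldiv0 cardsT.
Qed.

(** The abelian type is padded with entries 1 up to length k.  It is not longer
    than k since a product of r factors exceeding 1 is at least r. *)
Lemma abelian_isog_prod_cyclic (G : finGroupType) k : abelian [set: G] ->
    #|G| <= k ->
  exists s, [/\ size s = k, dvdn_chain s & [set: G] \isog [set: prod_cyclic s]].
Proof.
move=> cGG Gk; set t := abelian_type [set: G].
have tG : \prod_(d <- t) d = #|G|.
  rewrite -cardsT -card_Ldiv0 card_Ldiv_abelian_type//.
  by apply: eq_bigr => d _; rewrite gcd0n.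
have tk : size t <= k.
  apply: leq_trans Gk; rewrite -tG.
  have : all (leq 2) t by exact: abelian_type_gt1.
  elim: (t) => [|d s IH] /=; first by rewrite big_nil.
  move=> /andP[d1 sgt1]; have s1 := IH sgt1.
  have s0 : all (leq 1) s by apply: sub_all sgt1 => i /ltnW.
  rewrite big_cons; apply: (leq_trans (n := 2 * \prod_(x <- s) x)).
    by rewrite mul2n -addnn -add1n leq_add// prod_seq_gt0.
  by rewrite leq_mul2r d1 orbT.
have ct : dvdn_chain (t ++ nseq (k - size t) 1).
  exact/dvdn_chain_pad/abelian_type_chain.
exists (t ++ nseq (k - size t) 1); split=> //.
  by rewrite size_cat size_nseq subnKC.
apply/(isog_abelian_Ldiv cGG (prod_cyclic_abelian _)) => n.
rewrite card_Ldiv_prod_cyclic; last by case/andP: ct.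
by rewrite card_Ldiv_abelian_type// prod_gcd_pad.
Qed.

End GroupOfChain.

(** * Counting abelian groups of bounded order *)

Section Codes.
Local Open Scope nat_scope.
Variable N : nat.

(** A code (m, F) stands for the multiplicities m_1 = m and m_(k+2) = F k, where
    k starts at 0.  The single bound N, on the number and on the size of the
    entries, is enough for all groups of order at most N and makes the set of
    codes finite.  The order vanishes as soon as an entry is 0, so its
    positivity says that all entries are positive. *)
Definition tail_order (F : {ffun 'I_N -> 'I_N.+1}) := \prod_(k < N) F k ^ k.+2.

Definition code_order (c : 'I_N.+1 * {ffun 'I_N -> 'I_N.+1}) :=
  c.1 * tail_order c.2.

Definition codes n := [set c | 0 < code_order c <= n].

Definition mults (c : 'I_N.+1 * {ffun 'I_N -> 'I_N.+1}) : seq nat :=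
  val c.1 :: [seq val (c.2 k) | k <- enum 'I_N].

Lemma size_mults c : size (mults c) = N.+1.
Proof. by rewrite /= size_map size_enum_ord. Qed.

Lemma nth_mults c (k : 'I_N) : nth 0 (mults c) k.+1 = c.2 k.
Proof. by rewrite /= (nth_map k) ?size_enum_ord// nth_ord_enum. Qed.

Lemma mults_inj : injective mults.
Proof.
move=> c d cd; have [] := cd.
case: c d cd => [a F] [b G] /= cd /val_inj -> _; congr (_, _).
apply/ffunP => k; apply/val_inj.
by have := nth_mults (a, F) k; rewrite cd (nth_mults (b, G) k).
Qed.

Lemma mults_surj e : size e = N.+1 -> all (geq N) e -> exists c, mults c = e.
Proof.
case: e => //= a e [se] /andP[aN /allP eN].
exists (inord a, [ffun k : 'I_N => inord (nth 0 e k)]).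
rewrite /mults /= inordK//; congr (_ :: _).
apply: (@eq_from_nth _ 0); rewrite size_map size_enum_ord// => i iN.
rewrite (nth_map (Ordinal iN)) ?size_enum_ord//.
rewrite (nth_ord_enum (Ordinal iN) (Ordinal iN)).
by rewrite ffunE inordK// ltnS; apply: (eN (nth 0 e i)); rewrite mem_nth// se.
Qed.

Lemma prod_suffix_prods_mults c :
  \prod_(d <- suffix_prods (mults c)) d = code_order c.
Proof.
rewrite prod_suffix_prods size_mults big_ord_recl; congr (_ * _).
by apply: eq_bigr => k _; rewrite lift0 nth_mults.
Qed.

Lemma mults_gt0 c : 0 < code_order c -> all (leq 1) (mults c).
Proof.
rewrite -prod_suffix_prods_mults => c0; apply/allP => x /dvdn_prod_suffix_prods.
by move/dvdn_gt0; apply.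
Qed.

Definition code_group c := prod_cyclic (suffix_prods (mults c)).

Lemma card_code_group c : 0 < code_order c ->
  #|code_group c| = code_order c.
Proof.
move=> c0; have /suffix_prods_chain/andP[_ cc] := mults_gt0 c0.
by rewrite card_prod_cyclic// prod_suffix_prods_mults.
Qed.

Lemma code_group_inj c d : 0 < code_order c -> 0 < code_order d ->
  [set: code_group c] \isog [set: code_group d] -> c = d.
Proof.
move=> /mults_gt0 c0 /mults_gt0 d0 cd.
have cc := suffix_prods_chain c0; have cd' := suffix_prods_chain d0.
apply/mults_inj/suffix_prods_inj; rewrite ?size_mults//.
apply: dvdn_chain_eq_prod_gcd; rewrite ?size_suffix_prods ?size_mults// => n.
have [/andP[_ ?] /andP[_ ?]] := (cc, cd').
by rewrite -!card_Ldiv_prod_cyclic//; apply: card_Ldiv_isog.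
Qed.

(** The entries of the code are at most N because each of them divides the order
    of the group. *)
Lemma code_group_surj (G : finGroupType) : abelian [set: G] -> #|G| <= N ->
  exists2 c, code_order c = #|G| & [set: G] \isog [set: code_group c].
Proof.
move=> cGG GN; have [s [sN cs isoG]] := abelian_isog_prod_cyclic cGG (leqW GN).
have [e [e0 es ps]] := suffix_prods_surj cs.
have G0 : 0 < #|G| by rewrite -cardsT cardG_gt0.
have psG : \prod_(d <- suffix_prods e) d = #|G|.
  have /andP[_ s0] := cs.
  by rewrite ps -card_prod_cyclic// -!cardsT (card_isog isoG).
have [||c ce] := @mults_surj e; first by rewrite es.
  apply/allP => x /dvdn_prod_suffix_prods; rewrite psG => xG.
  by rewrite /= (leq_trans _ GN)// dvdn_leq.
exists c; last by rewrite /code_group ce ps.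
by rewrite -prod_suffix_prods_mults ce.
Qed.

Lemma abelian_class_count (R : realType) (x : R) n : n <= N ->
    (forall m, (m%:R <= x)%R = (m <= n)) ->
  is_class_count abelian_groups x #|codes n|.
Proof.
move=> nN xn; have cn (i : 'I_#|codes n|) := enum_valP i.
exists (fun i => code_group (enum_val i)); split.
- move=> i; have := cn i; rewrite inE => /andP[c0 cn'].
  split; first exact: prod_cyclic_abelian.
  by rewrite xn card_code_group.
- move=> i j; have := cn i; rewrite inE => /andP[c0 _].
  have := cn j; rewrite inE => /andP[d0 _].
  by move=> /(code_group_inj c0 d0)/enum_val_inj.
- move=> G [cGG]; rewrite xn => Gn.
  have [c cG isoG] := code_group_surj cGG (leq_trans Gn nN).
  have cc : c \in codes n.
    by rewrite inE cG Gn andbT -cardsT cardG_gt0.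
  by exists (enum_rank_in cc c); rewrite enum_rankK_in.
Qed.

(** For a fixed tail F, the admissible m are those with 0 < m |F| <= n.  A tail
    with a zero entry contributes n / 0 = 0 on both sides, so that the sum may
    run over all F. *)
Lemma card_codes n : n <= N -> #|codes n| = \sum_F n %/ tail_order F.
Proof.
move=> nN; rewrite -sum1_card.
rewrite (eq_bigl (fun c => 0 < code_order c <= n)); last first.
  by move=> c; rewrite inE.
rewrite -(pair_big_dep xpredT (fun m F => 0 < code_order (m, F) <= n)
                       (fun _ _ => 1)) /=.
rewrite (exchange_big_dep xpredT)//=; apply: eq_bigr => F _.
rewrite /code_order /=; set q := tail_order F.
have [->|q0] := posnP q.
  by rewrite divn0 big1// => m; rewrite muln0.
have -> : n %/ q = \sum_(1 <= m < (n %/ q).+1) 1.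
  by rewrite sum_nat_const_nat muln1 subSS subn0.
rewrite -(big_mkord (fun m => 0 < m * q <= n) (fun=> 1)).
rewrite [RHS](big_nat_widen _ _ N.+1) ?ltnS ?(leq_trans (leq_div _ _))//.
rewrite big_mkcond [RHS]big_mkcond big_ltn//= add0n.
rewrite big_nat_cond [RHS]big_nat_cond.
apply: eq_bigr => m /andP[/andP[m0 _] _]; rewrite muln_gt0 m0 q0 /= ltnS.
by rewrite leq_divRL.
Qed.

End Codes.

(** * Cancellation of the factor of order two *)

Section C2Count.
Local Open Scope nat_scope.

Lemma C2x_abelian (H : finGroupType) : abelian [set: H] -> abelian [set: C2x H].
Proof. by apply: pair_abelian; apply: ord_abelian. Qed.

(** The factor contributed by [C2] to each torsion number is positive, hence
    cancels. *)
Lemma C2x_isog (H K : finGroupType) : abelian [set: H] -> abelian [set: K] ->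
  [set: C2x H] \isog [set: C2x K] <-> [set: H] \isog [set: K].
Proof.
move=> cH cK; rewrite (isog_abelian_Ldiv (C2x_abelian cH) (C2x_abelian cK)).
rewrite (isog_abelian_Ldiv cH cK).
split=> e n; last by rewrite !card_Ldiv_pair e.
have := e n; rewrite !card_Ldiv_pair => /eqP; rewrite eqn_pmul2l => [/eqP//|].
by rewrite card_gt0; apply/set0Pn; exists 1%g; rewrite !inE expg1n eqxx.
Qed.

Lemma card_C2x (H : finGroupType) : #|C2x H| = #|H|.*2.
Proof. by rewrite card_prod card_ord mul2n. Qed.

(** If the groups [s i] represent the abelian groups of order at most x / 2,
    then the groups [C2 x s i] represent those of the form [C2 x H] of order at most
    x, irredundantly by cancellation. *)
Lemma C2x_class_count (R : realType) (x : R) M :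
  is_class_count abelian_groups (x / 2) M -> is_class_count C2x_groups x M.
Proof.
have le2 m : (m.*2%:R <= x)%R = (m%:R <= x / 2)%R.
  by rewrite ler_pdivlMr// -muln2 natrM.
move=> [s [sA sI sS]]; exists (fun i => C2x (s i)); split.
- move=> i; have [ci si] := sA i; split; last by rewrite card_C2x le2.
  by exists (s i); split; [exact: ci | exact: isog_refl].
- by move=> i j /C2x_isog e; apply/sI/e; [have [] := sA i | have [] := sA j].
- move=> G [[H [cH isoG]] Gx].
  have [|i Hi] := sS H.
    by split=> //; rewrite -le2 -card_C2x -cardsT -(card_isog isoG) cardsT.
  exists i; apply: isog_trans isoG _; apply/C2x_isog => //.
  by have [] := sA i.
Qed.

End C2Count.

(** * Comparing the counts at n and at n / 2 *)

Section Halving.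
Local Open Scope nat_scope.

Definition small_tails n : {set {ffun 'I_n -> 'I_n.+1}} :=
  [set F | 0 < tail_order F <= n].

(** Termwise in [card_codes]: floor(n / q) is twice floor(floor(n / 2) / q) plus
    the parity of floor(n / q), and this parity is 0 unless 0 < q <= n. *)
Lemma card_codes_half n :
  #|codes n n./2|.*2 <= #|codes n n| <= #|codes n n./2|.*2 + #|small_tails n|.
Proof.
have n2 : n./2 <= n by rewrite -divn2 leq_div.
have termP q : n %/ q = (n./2 %/ q).*2 + odd (n %/ q).
  by rewrite -[LHS]odd_double_half addnC -!divn2 -!divnMA mulnC.
rewrite !card_codes// -!muln2 big_distrl/= -sum1_card.
rewrite [X in _ + X]big_mkcond -big_split /=; apply/andP; split.
  by apply: leq_sum => F _; rewrite [leqRHS]termP muln2 leq_addr.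
apply: leq_sum => F _; rewrite [leqLHS]termP muln2 leq_add2l inE.
set q := tail_order F; have [->|q0] := posnP q; first by rewrite divn0.
by case: (leqP q n) => [_|nq]; [case: odd | rewrite divn_small].
Qed.

(** The tail with all entries 1, which stands for the cyclic groups, contributes
    n. *)
Lemma leq_card_codes n : n <= #|codes n n|.
Proof.
rewrite card_codes// (bigD1 [ffun=> inord 1])//= /tail_order.
rewrite big1 ?divn1 ?leq_addr//.
move=> k _; rewrite ffunE inordK ?exp1n//.
by case: n k => // -[].
Qed.

End Halving.

(** * Rankin's bound for the number of tails *)

Section Rankin.
Local Open Scope ring_scope.
Variable R : realType.

Definition root4 (m : nat) : R := Num.sqrt (Num.sqrt m%:R).

Lemma root4_ge0 m : 0 <= root4 m. Proof. exact: sqrtr_ge0. Qed.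

Lemma root4M : {morph root4 : m n / (m * n)%N >-> m * n}.
Proof. by move=> m n; rewrite /root4 natrM !sqrtrM ?sqrtr_ge0. Qed.

Lemma root4_1 : root4 1 = 1. Proof. by rewrite /root4 !sqrtr1. Qed.

Lemma root4X m k : root4 (m ^ k) = root4 m ^+ k.
Proof. by elim: k => [|k IH]; rewrite ?root4_1// expnS root4M IH exprS. Qed.

Lemma ler_root4 : {homo root4 : m n / (m <= n)%N >-> m <= n}.
Proof. by move=> m n mn; rewrite !ler_wsqrtr// ler_nat. Qed.

Lemma root4_expr4 m : root4 m ^+ 4 = m%:R.
Proof. by rewrite (exprM _ 2 2) !sqr_sqrtr ?sqrtr_ge0. Qed.

Lemma root4_gt0 m : (0 < m)%N -> 0 < root4 m.
Proof. by move=> m0; rewrite !sqrtr_gt0 ltr0n. Qed.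

(** Here the summand is m^(-3/2).  It is at most 2 / sqrt(m - 1) - 2 / sqrt(m),
    and these differences telescope. *)
Lemma sum_inv_root4_6 n :
  \sum_(2 <= m < n.+1) (root4 m ^- 6) <= 2.
Proof.
suff : \sum_(2 <= m < n.+1) (root4 m ^- 6) <= 2 - 2 / Num.sqrt n%:R \/ n = 0%N.
  case=> [h|->]; last by rewrite big_geq.
  by rewrite (le_trans h)// lerBlDr lerDl divr_ge0 ?sqrtr_ge0.
case: n => [|n]; [by right | left].
elim: n => [|n IH]; first by rewrite big_geq// sqrtr1 divr1 subrr.
rewrite big_nat_recr//= (le_trans (lerD IH (lexx _)))//.
have -> : root4 n.+2 ^+ 6 = Num.sqrt n.+2%:R ^+ 3.
  by rewrite (exprM _ 2 3) sqr_sqrtr ?sqrtr_ge0.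
set a := Num.sqrt n.+1%:R; set b := Num.sqrt n.+2%:R.
have a0 : 0 < a by rewrite sqrtr_gt0 ltr0n.
have ab : a <= b by rewrite ler_wsqrtr// ler_nat.
have b0 : 0 < b := lt_le_trans a0 ab.
have e : b ^+ 2 = a ^+ 2 + 1 by rewrite !sqr_sqrtr// -natr1.
have ba : b - a = (a + b)^-1.
  apply: (mulIf (x := a + b)); first by rewrite gt_eqF ?addr_gt0.
  rewrite mulVf; last by rewrite gt_eqF ?addr_gt0.
  by rewrite mulrC -[RHS](addrK (a ^+ 2)) [1 + _]addrC -e; ring.
have h : b ^- 3 <= 2 / a - 2 / b.
  have -> : 2 / a - 2 / b = 2 * (b - a) / (a * b).
    by field; rewrite !gt_eqF.
  rewrite ba -mulrA -invfM ler_pdivlMr ?mulr_gt0 ?addr_gt0// mulrC.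
  rewrite ler_pdivrMr ?exprn_gt0// exprS [b ^+ 2]expr2 [leRHS]mulrA ler_pM//.
  - by rewrite addr_ge0 ?ltW.
  - by rewrite mulr_ge0 ?ltW.
  - by rewrite mulr_natl mulr2n lerD.
  - by rewrite ler_pM2r.
lra.
Qed.

(** Bounds the product over k >= 0 of 1 + 2 q^k, where q = 2^(-3/4), through
    1 + t <= exp(t) and the sum of the geometric series. *)
Definition rankin_const : R := expR (2 / (1 - (root4 2)^-3)).

Lemma inv_root4_2_itv : 0 < (root4 2)^-3 < 1.
Proof.
rewrite invr_gt0 exprn_gt0 ?root4_gt0//=.
rewrite invf_lt1 ?exprn_gt0 ?root4_gt0// exprn_egt1//.
rewrite /root4 -[ltLHS]sqrtr1 -[X in Num.sqrt X]sqrtr1.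
by rewrite !ltr_sqrt ?sqrtr_gt0 ?ltr1n.
Qed.

(** A partial sum of zeta(3 (k + 2) / 4).  The terms m = 0 and m = 1 are 0 and
    1; for m >= 2, m^(-3 (k + 2) / 4) is at most m^(-3/2) 2^(-3 k / 4). *)
Lemma sum_root4_inv n k :
  \sum_(m < n.+1) root4 m ^- (3 * k.+2) <= 1 + 2 * ((root4 2)^-3) ^+ k.
Proof.
rewrite -(big_mkord xpredT (fun m => root4 m ^- (3 * k.+2))).
rewrite big_ltn// {1}/root4 !sqrtr0 expr0n/= invr0 add0r.
case: n => [|n].
  rewrite big_geq// addr_ge0// mulr_ge0// exprn_ge0//.
  by have /andP[/ltW] := inv_root4_2_itv.
rewrite big_ltn// root4_1 expr1n invr1 lerD2l.
rewrite (le_trans _ (ler_wpM2r _ (sum_inv_root4_6 n.+1)))//; last first.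
  by rewrite exprn_ge0//; have /andP[/ltW] := inv_root4_2_itv.
rewrite big_distrl/= big_nat_cond [leRHS]big_nat_cond.
apply: ler_sum => m /andP[/andP[m2 _] _].
have m0 : (0 < m)%N by exact: ltnW.
rewrite exprVn -exprM -invfM lef_pV2 ?posrE.
- rewrite (_ : 3 * k.+2 = 6 + 3 * k)%N; last by rewrite mulnS mulnS addnA.
  rewrite exprD ler_pM2l ?exprn_gt0 ?root4_gt0//.
  by rewrite lerXn2r ?nnegrE ?root4_ge0 ?ler_root4.
- by rewrite exprn_gt0// root4_gt0.
- by rewrite mulr_gt0 ?exprn_gt0 ?root4_gt0.
Qed.

(** Rankin's trick: each F with 0 < |F| <= n is counted with the weight
    (n / |F|)^(3/4) >= 1.  Summed over all F, the weights |F|^(-3/4) factor as a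
    product over the coordinates of F. *)
Lemma card_small_tails n :
  #|small_tails n|%:R <= rankin_const * root4 n ^+ 3.
Proof.
have tailE F : root4 (tail_order F) = \prod_(k < n) root4 (F k) ^+ k.+2.
  rewrite /tail_order (big_morph root4 root4M root4_1).
  by apply: eq_bigr => k _; rewrite root4X.
apply: (@le_trans _ _ (\sum_(F : {ffun 'I_n -> 'I_n.+1})
    root4 n ^+ 3 * \prod_(k < n) root4 (F k) ^- (3 * k.+2))).
  rewrite -sum1_card natr_sum big_mkcond; apply: ler_sum => F _.
  have -> : \prod_(k < n) root4 (F k) ^- (3 * k.+2) =
            root4 (tail_order F) ^- 3.
    rewrite tailE -prodrXl -prodfV; apply: eq_bigr => k _.
    by rewrite -exprM mulnC.
  rewrite inE; case: ifPn => [/andP[F0 Fn]|_].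
    rewrite ler_pdivlMr ?exprn_gt0 ?root4_gt0// mul1r.
    by rewrite lerXn2r ?nnegrE ?root4_ge0 ?ler_root4.
  by rewrite divr_ge0// exprn_ge0// root4_ge0.
rewrite -big_distrr/= mulrC ler_wpM2r ?exprn_ge0 ?root4_ge0//.
rewrite -(bigA_distr_bigA
  (fun (k : 'I_n) (m : 'I_n.+1) => root4 m ^- (3 * k.+2))).
have [q0 q1] := andP inv_root4_2_itv.
apply: (@le_trans _ _ (\prod_(k < n) expR (2 * (root4 2)^-3 ^+ k))).
  apply: ler_prod => k _; rewrite sumr_ge0 => [|m _]; last first.
    by rewrite invr_ge0 exprn_ge0 ?root4_ge0.
  by rewrite (le_trans (sum_root4_inv n k))// expR_ge1Dx.
rewrite -expR_sum ler_expR -big_distrr/= ler_wpM2l//.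
rewrite -(big_mkord xpredT (fun k => (root4 2)^-3 ^+ k)).
have := @geometric_le_lim R n 1 ((root4 2)^-3) ler01 q0.
rewrite gtr0_norm// => /(_ q1).
by rewrite /series /= mul1r; under eq_bigr do rewrite mul1r.
Qed.

End Rankin.

(** * The density *)

Section Density.
Local Open Scope classical_set_scope.
Local Open Scope ring_scope.

Lemma class_count_abelian (R : realType) (x : R) : 0 <= x ->
  class_count abelian_groups x = #|codes (Num.truncn x) (Num.truncn x)|.
Proof.
move=> x0; apply: is_class_count_unique (class_countP _ _) _.
by apply: abelian_class_count => // m; rewrite truncn_ge_nat.
Qed.

Lemma class_count_C2x (R : realType) (x : R) : 0 <= x ->
  class_count C2x_groups x = #|codes (Num.truncn x) (Num.truncn x)./2|.
Proof.
move=> x0; apply: is_class_count_unique (class_countP _ _) _.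
apply: C2x_class_count; apply: abelian_class_count => [|m].
  by rewrite -divn2 leq_div.
by rewrite ler_pdivlMr// -natrM -truncn_ge_nat// muln2 geq_half_double.
Qed.

(** With n the integer part of x, A(n) - 2 A(n / 2) is O(n^(3/4)) and A(n) >= n,
    so that the quotient is O(n^(-1/4)). *)
Lemma class_count_ratio (R : realType) (x : R) : 1 <= x ->
  `| 2^-1 - (class_count C2x_groups x)%:R / (class_count abelian_groups x)%:R |
    <= rankin_const R / root4 R (Num.truncn x).
Proof.
move=> x1; have x0 : 0 <= x by rewrite (le_trans ler01).
rewrite class_count_abelian// class_count_C2x//; set n := Num.truncn x.
have n0 : (0 < n)%N by rewrite truncn_gt0.
set A := #|codes n n|; set Q := #|codes n n./2|.
have /andP[QA AQ] := card_codes_half n.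
have nA : n%:R <= A%:R :> R by rewrite ler_nat leq_card_codes.
have A0 : 0 < A%:R :> R by rewrite (lt_le_trans _ nA)// ltr0n.
have d0 : 0 <= A%:R - Q%:R *+ 2 :> R by rewrite subr_ge0 -mulrnA ler_nat muln2.
have dG : A%:R - Q%:R *+ 2 <= rankin_const R * root4 R n ^+ 3.
  apply: le_trans (card_small_tails R n).
  by rewrite lerBlDl -mulrnA -natrD ler_nat muln2.
have -> : 2^-1 - Q%:R / A%:R = (A%:R - Q%:R *+ 2) / (2 * A%:R) :> R.
  by field; rewrite gt_eqF.
rewrite ger0_norm; last by rewrite divr_ge0// mulr_ge0// ltW.
rewrite ler_pdivrMr ?mulr_gt0// (le_trans dG)// -mulrA ler_wpM2l ?expR_ge0//.
rewrite ler_pdivlMl ?root4_gt0// -exprS root4_expr4 (le_trans nA)//.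
by rewrite ler_peMl ?ltW// ltr1n.
Qed.

Lemma density_C2x (R : realType) :
  (class_count C2x_groups x)%:R / (class_count abelian_groups x)%:R
       @[x --> (+oo : set_system R)] --> (2^-1 : R).
Proof.
apply/cvgrPdist_le => e e0; near=> x.
have x1 : 1 <= x by near: x; apply: nbhs_pinfty_ge; rewrite num_real.
apply: le_trans (class_count_ratio x1) _.
set n := Num.truncn x; have n0 : (0 < n)%N by rewrite truncn_gt0.
rewrite ler_pdivrMr ?root4_gt0// mulrC -ler_pdivrMr//.
have C0 : 0 <= rankin_const R / e by rewrite divr_ge0 ?expR_ge0// ltW.
(* The bound reads (C / e)^4 <= n, which holds once x >= (C / e)^4 + 1. *)
rewrite -(@ler_pXn2r _ 4)// ?nnegrE ?root4_ge0//.
rewrite root4_expr4 -(lerD2r 1) natr1.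
apply/ltW; apply: le_lt_trans (truncnS_gt x).
by near: x; apply: nbhs_pinfty_ge; rewrite num_real.
Unshelve. all: by end_near. Qed.

End Density.

Local Open Scope classical_set_scope.
Local Open Scope ring_scope.

Theorem lemma6p3 :
  (forall H : finGroupType, abelian [set: H]%SET ->
     realizable_in_char_zero (C2x H)) /\
  (forall R : realType,
     (class_count C2x_groups x)%:R / (class_count abelian_groups x)%:R
       @[x --> (+oo : set_system R)] --> (2^-1 : R)).
Proof.
by split=> [H|R]; [exact: C2x_realizable | exact: density_C2x].
Qed.
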